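(* Let $G$ be a finite simple graph on $n \ge 1$ vertices without isolated vertices, let $0=\lambda_0\le\lambda_1\le\dots\le\lambda_{n-1}$ be the eigenvalues (with multiplicity) of its normalized Laplacian matrix $\mathbf L = \mathbf I - \mathbf D^{-1/2}\mathbf A\mathbf D^{-1/2}$, and for an integer $0\le j\le n$ let $\sigma_j$ be the sum of the $j$ largest eigenvalues of $\mathbf L$. Let $k$ be an integer with $1\le k\le n$. If $\sigma_{k-1} < k$, then $k < \chi(G)$.
   Context: $\mathbf A$ is the adjacency matrix of $G$ and $\mathbf D$ is the diagonal matrix of vertex degrees. $\sigma_j=\sum_{i=1}^{j}\lambda_{n-i}$ (so $\sigma_0=0$). $\chi(G)$ is the chromatic number of $G$. *)

(* Defs.v *)
From HB Require Import structures.
From mathcomp Require Import all_boot all_order all_algebra.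
From mathcomp Require Import reals.

Set Implicit Arguments.
Unset Strict Implicit.
Unset Printing Implicit Defensive.

Import Order.TTheory GRing.Theory Num.Theory.
Local Open Scope ring_scope.

Record sgraph (T : finType) := SGraph {
  adj :> rel T;
  adj_sym : symmetric adj;
  adj_irr : irreflexive adj }.

Definition degree (T : finType) (G : sgraph T) (x : T) : nat :=
  #|[set y | G x y]|.

Definition no_isolated (T : finType) (G : sgraph T) : Prop :=
  forall x : T, exists y : T, G x y.

Definition colorable (T : finType) (G : sgraph T) (m : nat) : bool :=
  [exists c : {ffun T -> 'I_m}, [forall x, forall y, G x y ==> (c x != c y)]].

Lemma colorable_ex (T : finType) (G : sgraph T) : exists m, colorable G m.
Proof.
exists #|T|; apply/existsP; exists [ffun x => enum_rank x].
apply/forallP=> x; apply/forallP=> y; apply/implyP=> xy.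
rewrite !ffunE (inj_eq enum_rank_inj).
by apply: contraTneq xy => ->; rewrite adj_irr.
Qed.

Definition chromatic_number (T : finType) (G : sgraph T) : nat :=
  ex_minn (colorable_ex G).

(* Matrix rows and columns are indexed by the enumeration of the vertices. *)
Definition adjacency_mx (R : realType) (T : finType) (G : sgraph T) :
    'M[R]_#|T| :=
  \matrix_(i, j) (G (enum_val i) (enum_val j))%:R.

(* D^(-1/2); x^-1 is a genuine inverse only if no vertex is isolated. *)
Definition degree_mx_invsqrt (R : realType) (T : finType) (G : sgraph T) :
    'M[R]_#|T| :=
  diag_mx (\row_i (Num.sqrt (degree G (enum_val i))%:R)^-1).

Definition normalized_laplacian (R : realType) (T : finType) (G : sgraph T) :
    'M[R]_#|T| :=
  1%:M - degree_mx_invsqrt R G *m adjacency_mx R G *m degree_mx_invsqrt R G.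

(* lam lists the eigenvalues of M in nondecreasing order, each repeated
   according to its multiplicity as a root of the characteristic polynomial;
   for symmetric M such a list exists and is unique. *)
Definition is_ordered_spectrum (R : realType) (n : nat) (M : 'M[R]_n)
    (lam : n.-tuple R) : Prop :=
  sorted <=%R lam /\ char_poly M = \prod_(x <- lam) ('X - x%:P).

(* With lam sorted nondecreasingly and j <= n, the sum of the j largest
   entries of lam. *)
Definition sigma (R : realType) (n : nat) (lam : n.-tuple R) (j : nat) : R :=
  \sum_(1 <= i < j.+1) lam`_(n - i).

(* Main.v *)
Require Import Defs.
From HB Require Import structures.
From mathcomp Require Import all_boot all_order all_algebra.
From mathcomp Require Import reals.
From mathcomp Require Import perm spectral complex.
From mathcomp Require Import ring zify.

Set Implicit Arguments.
Unset Strict Implicit.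
Unset Printing Implicit Defensive.

Import Order.TTheory GRing.Theory Num.Theory.
Local Open Scope ring_scope.

(** Suppose that [chi(G) <= k]; then [sigma_(k-1) >= k], as follows.  Since
[k] is at most the number of vertices, colour classes can be split until there
is a proper colouring with exactly [k] nonempty classes ([colorable_onto]).

Let [w] be the vector of square roots of degrees, which [L] kills
([sqrt_degree_laplacian]).  Restricting [w] to the colour classes and
normalizing gives [k] orthonormal vectors, the rows of [class_mx].  A class
spans no edge, so the quadratic form of [L] takes the value 1 at each of them
([laplacian_class_diag]), and the compression of [L] to their span has trace
[k].  The span contains [w], so splitting off the line of [w] leaves a
projection [P] of rank [k - 1] ([deflated_projection]) with
[\tr (L P) = k - 0 = k].

Ky Fan's maximum principle ([symmetric_ky_fan]) bounds this trace by the sum of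
the [k - 1] largest eigenvalues.  In an orthonormal eigenbasis, [\tr (L P)] is
the sum of the eigenvalues weighted by the diagonal entries of [P]; these lie
between 0 and 1 and add up to [k - 1], so the weighted sum is greatest when the
whole weight sits on the top eigenvalues ([sum_weights_le_top]). *)

(** * Colourings that use every colour *)

Lemma colorable_widen (T : finType) (G : sgraph T) (m m' : nat) :
  (m <= m')%N -> colorable G m -> colorable G m'.
Proof.
move=> le_mm' /existsP[c /forallP c_proper]; apply/existsP.
exists [ffun x => widen_ord le_mm' (c x)].
apply/forallP=> x; apply/forallP=> y; apply/implyP=> xy; rewrite !ffunE.
by have /forallP/(_ y)/implyP/(_ xy) := c_proper x.
Qed.

(** A proper colouring with the largest possible number of used colours is
onto: if a colour were unused, two vertices would share a colour because
[m <= #|T|], and giving the unused colour to one of them would stay proper and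
use one more colour. *)
Lemma colorable_onto (T : finType) (G : sgraph T) (m : nat) :
  (m <= #|T|)%N -> colorable G m ->
  exists2 c : {ffun T -> 'I_m},
    (forall x y, G x y -> c x != c y) & (forall a, exists x, c x = a).
Proof.
move=> le_mn /existsP[c0 c0_proper].
pose proper (c : {ffun T -> 'I_m}) := [forall x, forall y, G x y ==> (c x != c y)].
case: (@arg_maxnP _ c0 proper (fun c => #|c @: T|) c0_proper) => c c_proper c_max.
have c_properP x y : G x y -> c x != c y.
  by move=> xy; have /forallP/(_ x)/forallP/(_ y)/implyP/(_ xy) := c_proper.
exists c => // a; have [/imsetP[x _ ->]|a_unused] := boolP (a \in c @: T).
  by exists x.
have [x [y [ne_xy eq_cxy]]] : exists x y, x != y /\ c x = c y.
  have /injectivePn[x [y ne_xy eq_cxy]] : ~~ injectiveb c.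
    apply/negP=> /injectiveP c_inj.
    have : (#|c @: T| < m)%N.
      rewrite -[X in (_ < X)%N]card_ord -cardsT; apply: proper_card.
      by apply/properP; split; [apply: subsetT | exists a].
    by rewrite card_imset // ltnNge le_mn.
  by exists x, y.
(* The colour of x survives in c', because y keeps it. *)
pose c' := [ffun z => if z == x then a else c z].
have c'_proper : proper c'.
  have c_neq_a z : c z != a.
    by apply: contraNneq a_unused => <-; rewrite imset_f.
  apply/forallP=> z; apply/forallP=> t; apply/implyP=> zt; rewrite !ffunE.
  have [zx|_] := eqVneq z x; have [tx|_] := eqVneq t x; rewrite ?c_neq_a //.
  - by rewrite zx tx adj_irr in zt.
  - by rewrite eq_sym c_neq_a.
  - exact: c_properP.
have := c_max c' c'_proper; rewrite /= leqNgt => /negP[].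
apply: proper_card; apply/properP; split; last first.
  by exists a => //; apply/imsetP; exists x => //; rewrite ffunE eqxx.
apply/subsetP=> _ /imsetP[z _ ->]; apply/imsetP.
have [-> | ne_zx] := eqVneq z x.
  by exists y => //; rewrite ffunE eq_sym (negPf ne_xy).
by exists z => //; rewrite ffunE (negPf ne_zx).
Qed.

(** * Weighted sums and Ky Fan's maximum principle *)

Lemma big_top (V : nmodType) (n j : nat) (F : nat -> V) : (j <= n)%N ->
  \sum_(1 <= i < j.+1) F (n - i)%N = \sum_(i < n | (n - j <= i)%N) F i.
Proof.
move=> le_jn; rewrite -(big_mkord (fun i => n - j <= i)%N) big_add1 /=.
rewrite [RHS](@big_cat_nat _ _ _ (n - j)%N) ?leq_subr //=.
rewrite [X in X + _]big_nat_cond [X in X + _]big_pred0 ?add0r; last first.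
  by move=> i; lia.
transitivity (\sum_(n - j <= i < n) F i); last first.
  by apply: congr_big_nat => // i; lia.
rewrite [LHS]big_nat_rev /= -{1}[(n - j)%N]add0n big_addn subKn //.
by apply: eq_big_nat => i /andP[_ lt_ij]; congr F; lia.
Qed.

(** The bathtub principle.  With [e] the indicator of the [j] top positions and
[t] a threshold separating these positions from the others, the difference of
the two sides is the sum of [(s_i - t) * (e_i - p_i)], because [e] and [p] have
the same total weight; the two factors never have opposite signs. *)
Lemma sum_weights_le_top (R : numDomainType) (n j : nat) (s : n.-tuple R)
    (p : 'I_n -> R) :
  sorted <=%R s -> (forall i, 0 <= p i <= 1) -> \sum_i p i = j%:R ->
  (j <= n)%N ->
  \sum_i tnth s i * p i <= \sum_(1 <= i < j.+1) s`_(n - i).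
Proof.
move=> s_sorted p01 p_sum le_jn.
(* The minimum only matters for j = 0, where no position is at the top and the
   largest entry serves as threshold. *)
pose e (i : 'I_n) : R := (n - j <= i)%:R; pose t := s`_(minn (n - j) n.-1).
have sum_e (F : nat -> R) :
    \sum_(1 <= i < j.+1) F (n - i)%N = \sum_(i < n) F i * e i.
  rewrite big_top // big_mkcond; apply: eq_bigr => i _.
  by rewrite /e; case: (n - j <= i)%N; rewrite ?mulr1 ?mulr0.
have e_sum : \sum_i e i = j%:R.
  have := sum_e (fun=> 1); rewrite sumr_const_nat subSS subn0 => ->.
  by apply: eq_bigr => i _; rewrite mul1r.
rewrite (sum_e (fun i => s`_i)) -subr_ge0 -sumrB.
have -> : \sum_(i < n) (s`_i * e i - tnth s i * p i)
        = \sum_(i < n) (s`_i - t) * (e i - p i).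
  rewrite -[LHS]subr0 -[X in _ - X](mulr0 t) -[X in t * X](subrr j%:R).
  rewrite -{1}e_sum -p_sum -sumrB mulr_sumr -sumrB.
  by apply: eq_bigr => i _; rewrite (tnth_nth 0); ring.
have s_mono := sorted_leq_nth le_trans lexx 0 s_sorted.
apply: sumr_ge0 => i _; rewrite /e; have /andP[p_ge0 p_le1] := p01 i.
have lt_in := ltn_ord i.
have [le_ji|lt_ij] := leqP (n - j) i.
  apply: mulr_ge0; rewrite subr_ge0 //.
  by apply: s_mono; rewrite ?inE ?size_tuple; lia.
rewrite sub0r mulrN -mulNr opprB mulr_ge0 // subr_ge0.
by apply: s_mono; rewrite ?inE ?size_tuple; lia.
Qed.

Lemma char_poly_conj (R : comUnitRingType) (n : nat) (A U : 'M[R]_n) :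
  U \in unitmx -> char_poly (invmx U *m A *m U) = char_poly A.
Proof.
move=> U_unit; rewrite /char_poly /char_poly_mx !map_mxM /=.
have VU : map_mx polyC (invmx U) *m map_mx polyC U = 1%:M.
  by rewrite -map_mxM mulVmx // map_mx1.
set V := map_mx polyC (invmx U) in VU *; set W := map_mx polyC U in VU *.
have -> : 'X%:M - V *m map_mx polyC A *m W = V *m ('X%:M - map_mx polyC A) *m W.
  by rewrite mulmxBr mulmxBl mul_mx_scalar -scalemxAl VU scalemx1.
by rewrite !det_mulmx mulrAC -det_mulmx VU det1 mul1r.
Qed.

Section ComplexKyFan.
Local Open Scope sesquilinear_scope.

(** The diagonal entry is the squared norm of row [i], as
[P = P P^*]. *)
Lemma hermitian_idem_diag_ge0 (C : numClosedFieldType) (n : nat) (P : 'M[C]_n) i :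
  P ^t* = P -> P *m P = P -> 0 <= P i i.
Proof.
move=> P_herm P_idem; rewrite -P_idem -{2}P_herm mxE sumr_ge0 // => j _.
by rewrite !mxE -normCK exprn_ge0.
Qed.

(** Conjugating [P] by a unitary matrix diagonalizing [A] gives a projection
[B] of the same trace with [\tr (A P)] the sum of the [d_i B_ii], where [d]
lists the eigenvalues of [A].  Both [B] and [1 - B] have nonnegative diagonal,
so the [B_ii] are admissible weights for the bathtub principle. *)
Lemma ky_fan (C : numClosedFieldType) (n j : nat) (A P : 'M[C]_n)
    (s : n.-tuple C) :
  A ^t* = A -> char_poly A = \prod_(x <- s) ('X - x%:P) -> sorted <=%R s ->
  P ^t* = P -> P *m P = P -> \tr P = j%:R -> (j <= n)%N ->
  \tr (A *m P) <= \sum_(1 <= i < j.+1) s`_(n - i).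
Proof.
move=> A_herm A_char s_sorted P_herm P_idem P_tr le_jn.
have A_hsym : A \is hermsymmx by apply/is_hermitianmxP; rewrite expr0 scale1r A_herm.
have /orthomx_spectralP A_diag := hermitian_normalmx A_hsym.
set U := spectralmx A in A_diag; set d := spectral_diag A in A_diag.
have U_unitary : U \is unitarymx := spectral_unitarymx A.
have UV : U *m U ^t* = 1%:M := unitarymxP U_unitary.
have VU : U ^t* *m U = 1%:M by apply: mulmx1C.
rewrite invmx_unitary // in A_diag.
pose B := U *m P *m U ^t*.
have B_herm : B ^t* = B.
  by rewrite /B !trmx_mul !map_mxM /= trmxCK P_herm mulmxA.
have B_idem : B *m B = B.
  by rewrite /B !mulmxA -(mulmxA _ (U ^t*) U) VU mulmx1 -(mulmxA U) P_idem.
have B_tr : \tr B = j%:R by rewrite /B mxtrace_mulC mulmxA VU mul1mx.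
have B01 i : 0 <= B i i <= 1.
  rewrite hermitian_idem_diag_ge0 //= -subr_ge0.
  have -> : 1 - B i i = (1%:M - B) i i by rewrite !mxE eqxx.
  apply: hermitian_idem_diag_ge0.
    by rewrite linearB map_mxB /= trmx1 map_mx1 B_herm.
  by rewrite mulmxBr !mulmxBl !mul1mx mulmx1 B_idem subrr subr0.
(* The spectral theorem lists the eigenvalues in an arbitrary order; unique
   factorization of the characteristic polynomial matches them with s. *)
have : perm_eq s [seq d 0 i | i : 'I_n].
  apply: prod_XsubC_eq; rewrite -A_char A_diag -(invmx_unitary U_unitary).
  rewrite char_poly_conj ?unitarymx_unit // char_poly_trig ?diag_mx_is_trig //.
  rewrite big_image /=; apply: eq_bigr => i _; by rewrite mxE eqxx.
rewrite perm_sym => /tuple_permP[f f_eq].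
have d_eq i : d 0 i = tnth s (f i).
  have := congr1 (fun r => nth 0 r i) f_eq.
  rewrite -tnth_nth tnth_mktuple => <-.
  by rewrite (nth_map i) ?nth_ord_enum ?size_enum_ord.
have -> : \tr (A *m P) = \sum_i d 0 i * B i i.
  rewrite {1}A_diag -!mulmxA mxtrace_mulC -!mulmxA /mxtrace.
  by apply: eq_bigr => i _; rewrite mul_diag_mx mxE !mulmxA.
rewrite (reindex_inj (@perm_inj _ f^-1)) /=.
rewrite (eq_bigr (fun i => tnth s i * B (f^-1 i)%g (f^-1 i)%g)); last first.
  by move=> i _; rewrite d_eq permKV.
apply: sum_weights_le_top => //.
by rewrite -B_tr /mxtrace [RHS](reindex_inj (@perm_inj _ f^-1)).
Qed.

End ComplexKyFan.

(** The real case follows by complexification, which preserves the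
characteristic polynomial, the traces and the order. *)
Lemma symmetric_ky_fan (R : rcfType) (n j : nat) (A P : 'M[R]_n)
    (s : n.-tuple R) :
  A^T = A -> char_poly A = \prod_(x <- s) ('X - x%:P) -> sorted <=%R s ->
  P^T = P -> P *m P = P -> \tr P = j%:R -> (j <= n)%N ->
  \tr (A *m P) <= \sum_(1 <= i < j.+1) s`_(n - i).
Proof.
move=> A_sym A_char s_sorted P_sym P_idem P_tr le_jn.
pose f : {rmorphism R -> R[i]} := real_complex R.
have f_herm (M : 'M[R]_n) : M^T = M -> ((map_mx f M)^T ^ Num.conj)%sesqui = map_mx f M.
  move=> M_sym; rewrite map_trmx M_sym; apply/matrixP => a b.
  by rewrite !mxE; exact: conjc_real.
have := @ky_fan _ n j (map_mx f A) (map_mx f P) (map_tuple f s) (f_herm _ A_sym).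
rewrite -map_char_poly A_char rmorph_prod big_map -!map_mxM !trace_map_mx P_tr.
rewrite rmorph_nat P_idem => /(_ _ _ (f_herm _ P_sym) erefl erefl le_jn).
rewrite (eq_big_nat _ _ (F2 := fun i => f s`_(n - i))); last first.
  move=> i /andP[i_gt0 le_ij].
  by rewrite (nth_map 0) // size_tuple; lia.
rewrite -rmorph_sum -[_ <= _]/(_%:C%C <= _%:C%C) lecR; apply.
  by apply: eq_bigr => x _; rewrite /= map_polyXsubC.
by rewrite sorted_map; apply: sub_sorted s_sorted => x y; rewrite /= lecR.
Qed.

(** * Projections attached to a partition *)

(** [P] is the orthogonal projection onto the orthogonal complement of [v] in
the row space of [W]; the third hypothesis says that [v] lies in that row
space. *)
Lemma deflated_projection (F : fieldType) (m n : nat) (W : 'M[F]_(m, n))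
    (v : 'rV[F]_n) :
  W *m W^T = 1%:M -> v *m v^T = 1%:M -> v *m W^T *m W = v ->
  let P := W^T *m W - v^T *m v in
  [/\ P^T = P, P *m P = P & \tr P = m%:R - 1].
Proof.
move=> W_orth v_unit vW /=; split.
- by rewrite linearB /= !trmx_mul !trmxK.
- set Q := W^T *m W; set E := v^T *m v.
  have QQ : Q *m Q = Q by rewrite /Q mulmxA -(mulmxA _ W) W_orth mulmx1.
  have EQ : E *m Q = E by rewrite /E /Q -mulmxA [v *m _]mulmxA vW.
  have QE : Q *m E = E.
    have E_sym : E^T = E by rewrite /E trmx_mul trmxK.
    have Q_sym : Q^T = Q by rewrite /Q trmx_mul trmxK.
    by apply: trmx_inj; rewrite trmx_mul E_sym Q_sym.
  have EE : E *m E = E by rewrite /E mulmxA -(mulmxA _ v) v_unit mulmx1.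
  by rewrite mulmxBr !mulmxBl QQ EQ QE EE subrr subr0.
- by rewrite linearB /= !(mxtrace_mulC _^T) W_orth v_unit !mxtrace1.
Qed.

Section ClassMatrix.
Variables (R : rcfType) (m n : nat) (c : 'I_n -> 'I_m) (w : 'rV[R]_n).

Definition class_norm (a : 'I_m) : R := Num.sqrt (\sum_(i | c i == a) w 0 i ^+ 2).

Definition class_mx : 'M[R]_(m, n) :=
  \matrix_(a, i) ((c i == a)%:R * w 0 i / class_norm a).

Hypothesis w_gt0 : forall i, 0 < w 0 i.

Lemma class_norm_sqr a : class_norm a ^+ 2 = \sum_(i | c i == a) w 0 i ^+ 2.
Proof. by rewrite sqr_sqrtr // sumr_ge0 // => i _; rewrite sqr_ge0. Qed.

Lemma class_norm_gt0 i : 0 < class_norm (c i).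
Proof.
rewrite sqrtr_gt0 (bigD1 i) //= ltr_pwDl ?exprn_gt0 //.
by rewrite sumr_ge0 // => k _; rewrite sqr_ge0.
Qed.

Lemma class_mx_orthonormal :
  (forall a, exists i, c i = a) -> class_mx *m class_mx^T = 1%:M.
Proof.
move=> c_onto; apply/matrixP => a b; rewrite !mxE.
have [<-|ne_ab] := eqVneq a b; last first.
  rewrite big1 // => i _; rewrite !mxE.
  have [-> | _] := eqVneq (c i) a; last by rewrite !mul0r.
  by rewrite (negPf ne_ab) !mul0r mulr0.
have /negPf norm_neq0 : class_norm a != 0.
  by have [i <-] := c_onto a; rewrite gt_eqF ?class_norm_gt0.
transitivity ((\sum_(i | c i == a) w 0 i ^+ 2) / class_norm a ^+ 2).
  rewrite mulr_suml [RHS]big_mkcond; apply: eq_bigr => i _; rewrite !mxE.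
  by case: (c i == a); rewrite ?mul0r // !mul1r; field; rewrite norm_neq0.
by rewrite -class_norm_sqr divff // expf_eq0 norm_neq0.
Qed.

(** [w] is the sum of its restrictions to the classes, so it lies in the row
space of [class_mx] and is fixed by the projection onto it. *)
Lemma class_mx_weight : w *m class_mx^T *m class_mx = w.
Proof.
apply/rowP=> i; rewrite mxE (bigD1 (c i)) //= big1 ?addr0; last first.
  by move=> a ne_a; rewrite !mxE eq_sym (negPf ne_a) !mul0r mulr0.
have norm_neq0 : class_norm (c i) != 0 by rewrite gt_eqF ?class_norm_gt0.
rewrite !mxE eqxx mul1r.
rewrite (eq_bigr (fun k => (if c k == c i then w 0 k ^+ 2 else 0) / class_norm (c i))).
  by rewrite -mulr_suml -big_mkcond -class_norm_sqr; field.
by move=> k _; rewrite !mxE; case: (c k == c i); rewrite ?mul0r ?mulr0 //=; ring.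
Qed.

End ClassMatrix.

(** * The normalized Laplacian *)

Section Laplacian.
Variables (R : realType) (T : finType) (G : sgraph T).
Local Notation n := #|T|.
Local Notation L := (normalized_laplacian R G).

Definition sqrt_degree : 'rV[R]_n :=
  \row_i Num.sqrt (degree G (enum_val i))%:R.

Lemma laplacianE i j :
  L i j = (i == j)%:R
    - (G (enum_val i) (enum_val j))%:R / (sqrt_degree 0 i * sqrt_degree 0 j).
Proof. by rewrite /normalized_laplacian mul_mx_diag mul_diag_mx !mxE invfM; ring. Qed.

Lemma laplacian_sym : L^T = L.
Proof.
by apply/matrixP => i j; rewrite mxE !laplacianE eq_sym adj_sym [X in _ / X]mulrC.
Qed.

Hypothesis G_noisol : no_isolated G.

Lemma sqrt_degree_gt0 i : 0 < sqrt_degree 0 i.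
Proof.
rewrite mxE sqrtr_gt0 ltr0n card_gt0; apply/set0Pn.
by have [y xy] := G_noisol (enum_val i); exists y; rewrite inE.
Qed.

Lemma sqrt_degree_sqr i :
  sqrt_degree 0 i ^+ 2 = \sum_(j < n) (G (enum_val i) (enum_val j))%:R.
Proof.
rewrite mxE sqr_sqrtr ?ler0n //; set x := enum_val i.
rewrite -(big_enum_val (fun y => (G x y)%:R)).
rewrite /degree -sum1_card natr_sum big_mkcond; apply: eq_bigr => y _.
by rewrite inE; case: (G _ y).
Qed.

(** With [w] the row [sqrt_degree], [w D^(-1/2)] is the all-ones row, [A] maps
it to the row of degrees, and [D^(-1/2)] maps the latter back to [w]. *)
Lemma sqrt_degree_laplacian : sqrt_degree *m L = 0.
Proof.
apply/rowP=> j; rewrite [LHS]mxE [RHS]mxE.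
have d_neq0 i : sqrt_degree 0 i != 0 by rewrite gt_eqF ?sqrt_degree_gt0.
transitivity (\sum_i (sqrt_degree 0 i * (i == j)%:R)
   - \sum_(i < n) (G (enum_val j) (enum_val i))%:R / sqrt_degree 0 j).
  rewrite -sumrB; apply: eq_bigr => i _; rewrite laplacianE [adj G _ _]adj_sym.
  by field; rewrite !d_neq0.
rewrite -mulr_suml -sqrt_degree_sqr (bigD1 j) //= eqxx mulr1 big1 => [|i /negPf->].
  by field; rewrite d_neq0.
by rewrite mulr0.
Qed.

(** Row [a] of [W] is supported on a class without edges, where [L] coincides
with the identity matrix. *)
Lemma laplacian_class_diag (m : nat) (c : 'I_n -> 'I_m) (a : 'I_m) :
  (forall i j, G (enum_val i) (enum_val j) -> c i != c j) ->
  let W := class_mx c sqrt_degree in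
  (W *m L *m W^T) a a = (W *m W^T) a a.
Proof.
move=> c_proper W; rewrite !mxE; apply: eq_bigr => j _; rewrite [W^T j a]mxE.
have [cj|] := boolP (c j == a); last by move=> /negPf cj; rewrite ![W a j]mxE cj !mul0r !mulr0.
congr (_ * _); rewrite mxE (bigD1 j) //= big1 ?addr0.
  by rewrite laplacianE eqxx adj_irr mul0r subr0 mulr1.
move=> i ne_ij; rewrite laplacianE (negPf ne_ij) [W a i]mxE.
have [ci|_] := eqVneq (c i) a; last by rewrite !mul0r.
have [ij|_] := boolP (G _ _); last by rewrite mul0r subr0 mulr0.
by have := c_proper _ _ ij; rewrite ci (eqP cj) eqxx.
Qed.

End Laplacian.

Theorem theorem2 (R : realType) (T : finType) (G : sgraph T)
    (n_ge1 : (1 <= #|T|)%N) (G_noisol : no_isolated G)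
    (lam : #|T|.-tuple R)
    (lam_spec : is_ordered_spectrum (normalized_laplacian R G) lam)
    (k : nat) (k_ge1 : (1 <= k)%N) (k_le_n : (k <= #|T|)%N)
    (sigma_lt : sigma lam (k - 1) < k%:R) :
  (k < chromatic_number G)%N.
Proof.
rewrite ltnNge; apply/negP => chi_le_k; move: sigma_lt; apply/negP; rewrite -leNgt.
have G_col : colorable G k.
  by apply: colorable_widen chi_le_k _; rewrite /chromatic_number; case: ex_minnP.
have [c c_proper c_onto] := colorable_onto k_le_n G_col.
have [lam_sorted lam_char] := lam_spec.
set L := normalized_laplacian R G in lam_char *.
pose w := sqrt_degree R G; have w_gt0 := sqrt_degree_gt0 R G_noisol.
pose ci (i : 'I_#|T|) := c (enum_val i); pose W := class_mx ci w.
have W_orth : W *m W^T = 1%:M.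
  apply: class_mx_orthonormal => // a; have [x <-] := c_onto a.
  by exists (enum_rank x); rewrite /ci enum_rankK.
pose norm := (w *m w^T) 0 0.
have norm_gt0 : 0 < norm.
  rewrite /norm mxE (bigD1 (Ordinal n_ge1)) //= ltr_pwDl //.
    by rewrite [w^T _ _]mxE mulr_gt0.
  by rewrite sumr_ge0 // => i _; rewrite [w^T _ _]mxE -expr2 sqr_ge0.
pose v := (Num.sqrt norm)^-1 *: w.
have v_unit : v *m v^T = 1%:M.
  rewrite linearZ /= -scalemxAl -scalemxAr scalerA [w *m _]mx11_scalar -/norm.
  by rewrite scale_scalar_mx -invfM -expr2 sqr_sqrtr ?ltW // mulVf ?gt_eqF.
have vW : v *m W^T *m W = v by rewrite -!scalemxAl class_mx_weight.
have [P_sym P_idem P_tr] := deflated_projection W_orth v_unit vW.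
have le_k1n : (k - 1 <= #|T|)%N by lia.
have P_rank : \tr (W^T *m W - v^T *m v) = (k - 1)%:R by rewrite P_tr natrB.
apply: le_trans (symmetric_ky_fan (laplacian_sym R G) lam_char lam_sorted
  P_sym P_idem P_rank le_k1n).
rewrite -/L mulmxBr linearB /= !mulmxA !(mxtrace_mulC _ v) !(mxtrace_mulC _ W) !mulmxA.
have -> : v *m L = 0 by rewrite -scalemxAl sqrt_degree_laplacian ?scaler0.
rewrite mul0mx mxtrace0 subr0 /mxtrace (eq_bigr (fun=> 1)) ?sumr_const ?card_ord //.
move=> a _; rewrite laplacian_class_diag; last by move=> i j; apply: c_proper.
by rewrite -/W W_orth mxE eqxx.
Qed.
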